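(* Let $(z_{\mathcal{E}},\lambda_{\mathcal{E}})$ be a KKT pair up to $\mathcal{E}$ of (RMP) and consider the dual problem (RMD) with respect to $(z_{\mathcal{E}},\lambda_{\mathcal{E}})$. Assume that $(y,\lambda)$ is a feasible solution of (RMD), i.e. $(y,\lambda)\in\Omega_D$. If $(f,g)$ is generalized convex on $S$ at $y$ and $$g_j(x)\le g_j(y)\quad\forall x\in\Omega,\ j\in J,$$ then there is no $x\in\Omega$ such that $$f_i(x)\le_{LU}f_i(y)-\frac{\mathcal{E}_i}{\sqrt\theta}\|x-y\|\quad\forall i\in I,$$ with at least one strict inequality (i.e. with $<_{LU}$ for at least one index in $I$).
   Context: Setting. $\mathbb{R}^n$ carries the Euclidean norm $\|\cdot\|$; $\mathbb{B}$ is its closed unit ball and $B(x,\rho)$ the open ball. $I=\{1,\ldots,m\}$, $J=\{1,\ldots,p\}$. $\mathcal{K}_c$ is the set of closed bounded intervals $[a^L,a^U]$, $a^L\le a^U$. $S\subset\mathbb{R}^n$ is nonempty and closed. For $i\in I$, $f_i(x)=[f_i^L(x),f_i^U(x)]\in\mathcal{K}_c$, where $f_i^L,f_i^U:\mathbb{R}^n\to\mathbb{R}$ are locally Lipschitz with $f_i^L(x)\le f_i^U(x)$; $f:=(f_1,\ldots,f_m)$. For $j\in J$, $\mathcal{V}_j\subset\mathbb{R}^{n_j}$ is nonempty compact and $g_j:\mathbb{R}^n\times\mathbb{R}^{n_j}\to\mathbb{R}$. Put $g_j(x):=\max_{v_j\in\mathcal{V}_j}g_j(x,v_j)$, $\mathcal{V}_j(x):=\{v_j\in\mathcal{V}_j: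 g_j(x,v_j)=g_j(x)\}$ and $g:=(g_1,\ldots,g_p)$. Standing conditions on $g_j$: for every $\bar x\in\mathbb{R}^n$ and $j\in J$ there is $\delta>0$ such that (a) $v_j\in\mathcal{V}_j\mapsto g_j(x,v_j)$ is upper semicontinuous for each $x\in B(\bar x,\delta)$, and the functions $g_j(\cdot,v_j)$, $v_j\in\mathcal{V}_j$, are Lipschitz on $B(\bar x,\delta)$ with a common constant $K_j$; (b) the multifunction $(x,v_j)\in B(\bar x,\delta)\times\mathcal{V}_j\rightrightarrows\partial_x g_j(x,v_j)$ is closed at $(\bar x,\bar v_j)$ for each $\bar v_j\in\mathcal{V}_j(\bar x)$ (i.e. if $(x^k,v^k)\to(\bar x,\bar v_j)$, $x_k^*\in\partial_x g_j(x^k,v^k)$, $x_k^*\to x^*$, then $x^*\in\partial_x g_j(\bar x,\bar v_j)$). $N(x;S)$ is the limiting (Mordukhovich) normal cone to $S$ at $x$; $\partial$ is the limiting (Mordukhovich) subdifferential, $\partial_x$ the limiting subdifferential in the variable $x$; $\mathrm{co}$ denotes convex hull; $C^\circ:=\{x^*:\langle x^*,x\rangle\le0\ \forall x\in C\}$ is the polar cone. Fix reals $0\le\epsilon_i^L\le\epsilon_i^U$, $i\in I$, with $\theta:=\sum_{i\in I}(\epsilon_i^L+\epsilon_i^U)>0$. Put $\mathcal{E}_i:=[\epsilon_i^L,\epsilon_i^U]$, $\mathcal{E}:=(\mathcal{E}_1,\ldots,\mathcal{E}_m)$. (RMP) is the problem of minimizing $f$ (in the order $\le_{LU}$ componentwise)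 over $\Omega:=\{x\in S: g_j(x,v_j)\le0\ \forall v_j\in\mathcal{V}_j,\ \forall j\in J\}=\{x\in S: g_j(x)\le0,\ j\in J\}$. Put $\Omega_{\mathcal{E}}:=\{x\in S: g_j(x)\le\sqrt{\theta},\ j\in J\}$. Intervals: $[a^L,a^U]-[b^L,b^U]=[a^L-b^U,a^U-b^L]$; $k[a^L,a^U]=[ka^L,ka^U]$ for $k\ge0$; $A\le_{LU}B$ iff $a^L\le b^L$ and $a^U\le b^U$; $A<_{LU}B$ iff $A\le_{LU}B$ and $A\ne B$. A pair $(z,\lambda)\in\Omega_{\mathcal{E}}\times\mathbb{R}^p_+$ is a KKT pair up to $\mathcal{E}$ of (RMP) if $0\in\sum_{i\in I}[\partial f_i^L(z)+\partial f_i^U(z)]+\sum_{j\in J}\lambda_j\,\mathrm{co}\{\partial_x g_j(z,v_j): v_j\in\mathcal{V}_j(z)\}+N(z;S)+\sqrt{\theta}\,\mathbb{B}$; $\lambda_j>0$ for all $j\in J$ with $0<g_j(z)\le\sqrt\theta$; and $\lambda_j=0$ if $g_j(z)\le0$. Dual problem (RMD) with respect to a KKT pair $(z_{\mathcal{E}},\lambda_{\mathcal{E}})$, $\lambda_{\mathcal{E}}=(\lambda_{1\mathcal{E}},\ldots,\lambda_{p\mathcal{E}})$: maximize (in the order $\le_{LU}$ componentwise) $L(y,\lambda)=(L_1(y,\lambda),\ldots,L_m(y,\lambda))$, where $L_i(y,\lambda)=[f_i^L(y)+\frac1{2m}\sum_{j\in J}\lambda_jg_j(y),\ f_i^U(y)+\frac1{2m}\sum_{j\in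 J}\lambda_jg_j(y)]$, over the feasible set $\Omega_D$ of all $(y,\lambda)\in S\times\mathbb{R}^p_+$ such that $0\in\sum_{i\in I}[\partial f_i^L(y)+\partial f_i^U(y)]+\sum_{j\in J}\lambda_j\,\mathrm{co}\{\partial_xg_j(y,v_j):v_j\in\mathcal{V}_j(y)\}+N(y;S)+\sqrt\theta\,\mathbb{B}$ and $\lambda_j\le\lambda_{j\mathcal{E}}$ for all $j\in J(\mathcal{E}):=\{j\in J:0<g_j(z_{\mathcal{E}})\le\sqrt\theta\}$. $(f,g)$ is generalized convex on $S$ at $z\in S$ if for any $x\in S$, $z_i^{*L}\in\partial f_i^L(z)$, $z_i^{*U}\in\partial f_i^U(z)$, $i\in I$, and $x^*_{v_j}\in\partial_x g_j(z,v_j)$, $v_j\in\mathcal{V}_j(z)$, $j\in J$, there exists $\omega\in[N(z;S)]^\circ$ satisfying: $f_i^L(x)-f_i^L(z)\ge\langle z_i^{*L},\omega\rangle$ and $f_i^U(x)-f_i^U(z)\ge\langle z_i^{*U},\omega\rangle$ for all $i\in I$; $g_j(x,v_j)-g_j(z,v_j)\ge\langle x^*_{v_j},\omega\rangle$ for $v_j\in\mathcal{V}_j(z)$, $j\in J$; and $\langle b^*,\omega\rangle\le\|x-z\|$ for all $b^*\in\mathbb{B}$.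
   Formalization: Generalized convexity is required with one ω serving any finite family of subgradients, where a single v_j may carry several elements of ∂_x g_j(z,v_j); with only one subgradient per v_j the claim fails, e.g. for g(x)=x_2-|x_1|, f=[-2x_2,-2x_2], y=0. *)

(* Defs.v *)
From HB Require Import structures.
From mathcomp Require Import all_boot all_order all_algebra.
From mathcomp Require Import all_classical all_reals all_analysis.

Set Implicit Arguments.
Unset Strict Implicit.
Unset Printing Implicit Defensive.

Import Order.TTheory GRing.Theory Num.Theory.
Import numFieldNormedType.Exports.

Local Open Scope classical_set_scope.
Local Open Scope ring_scope.

(* The library norm on ['rV[R]_n] is the sup norm, so the Euclidean norm is
   defined here; the library topology of ['rV[R]_n] is the usual one. *)

Section Euclidean.
Variables (R : realType) (n : nat).
Implicit Types (x y : 'rV[R]_n) (A C : set 'rV[R]_n).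

Definition dotp x y : R := \sum_(i < n) x ord0 i * y ord0 i.

Definition enorm x : R := Num.sqrt (dotp x x).

Definition eball x (r : R) : set 'rV[R]_n := [set y | enorm (y - x) < r].

Definition unit_ball : set 'rV[R]_n := [set x | enorm x <= 1].

Definition polar_cone C : set 'rV[R]_n :=
  [set xs | forall x, C x -> dotp xs x <= 0].

Definition convex_hull A : set 'rV[R]_n :=
  [set x | exists k (a : 'I_k -> R) (u : 'I_k -> 'rV[R]_n),
    [/\ forall i, 0 <= a i, \sum_(i < k) a i = 1, forall i, A (u i) &
        x = \sum_(i < k) a i *: u i]].

Definition lipschitz_with (K : R) A (phi : 'rV[R]_n -> R) : Prop :=
  forall x y, A x -> A y -> `|phi x - phi y| <= K * enorm (x - y).

Definition locally_lipschitz (phi : 'rV[R]_n -> R) : Prop :=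
  forall x, exists d K : R, 0 < d /\ lipschitz_with K (eball x d) phi.

End Euclidean.

Section Variational.
Variables (R : realType).

(* The limsup is over u -> x with u in S and u != x; at an isolated point of S
   it is -oo, so that every vector is a normal. *)
Definition frechet_normal n (S : set 'rV[R]_n) (x : 'rV[R]_n) :
    set 'rV[R]_n :=
  [set xs | S x /\
    (limf_esup (fun u : 'rV[R]_n => (dotp xs (u - x) / enorm (u - x))%:E)
               (within S x^') <= 0)%E].

Definition limiting_normal n (S : set 'rV[R]_n) (x : 'rV[R]_n) :
    set 'rV[R]_n :=
  [set xs | S x /\
    exists (u us : nat -> 'rV[R]_n),
      [/\ u @ \oo --> x, us @ \oo --> xs &
          forall k, frechet_normal S (u k) (us k)]].

(* R^n x R is 'rV_(n + 1), the last coordinate being the value. *)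
Definition epigraph n (phi : 'rV[R]_n -> R) : set 'rV[R]_(n + 1) :=
  [set w | exists x a, w = row_mx x (const_mx a) /\ phi x <= a].

Definition limiting_subdiff n (phi : 'rV[R]_n -> R) (x : 'rV[R]_n) :
    set 'rV[R]_n :=
  [set xs | limiting_normal (epigraph phi)
              (row_mx x (const_mx (phi x))) (row_mx xs (const_mx (- 1)))].

End Variational.

(* The pair (a, b) stands for the interval with endpoints a and b; equality of
   intervals is equality of endpoints when is_Kc holds. *)

Section Intervals.
Variable R : realType.
Implicit Types A B : R * R.

Definition is_Kc A : Prop := A.1 <= A.2.

Definition isub A B : R * R := (A.1 - B.2, A.2 - B.1).

(* Only meant for 0 <= k. *)
Definition iscale (k : R) A : R * R := (k * A.1, k * A.2).

Definition leLU A B : Prop := A.1 <= B.1 /\ A.2 <= B.2.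

Definition ltLU A B : Prop := leLU A B /\ A <> B.

End Intervals.

Definition usc_on (R : realType) (T : topologicalType) (V : set T)
    (h : T -> R) : Prop :=
  forall v, V v -> forall e : R, 0 < e ->
    \forall w \near within V (nbhs v), h w < h v + e.

Section Robust.
Variables (R : realType) (n m p : nat) (q : 'I_p -> nat).
Variables (S : set 'rV[R]_n).
Variables (f : 'I_m -> 'rV[R]_n -> R * R).
Variables (g : forall j : 'I_p, 'rV[R]_n -> 'rV[R]_(q j) -> R).
Variables (V : forall j : 'I_p, set 'rV[R]_(q j)).
Arguments g : clear implicits.
Arguments V : clear implicits.

Definition fL i x : R := (f i x).1.
Definition fU i x : R := (f i x).2.

(* Under the standing conditions below and for V_j nonempty and compact, this
   supremum is finite and attained. *)
Definition gmax j x : R := sup [set g j x v | v in V j].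

Definition active j x : set 'rV[R]_(q j) :=
  [set v | V j v /\ g j x v = gmax j x].
Arguments active : clear implicits.

Definition dxg (j : 'I_p) (x : 'rV[R]_n) (v : 'rV[R]_(q j)) : set 'rV[R]_n :=
  limiting_subdiff (fun u => g j u v) x.
Arguments dxg : clear implicits.

Definition standing_conditions : Prop :=
  forall (xb : 'rV[R]_n) (j : 'I_p), exists d : R,
    [/\ 0 < d,
        forall x, eball xb d x -> usc_on (V j) (g j x),
        exists K : R, forall v, V j v ->
          lipschitz_with K (eball xb d) (fun x => g j x v) &
        forall vb, active j xb vb ->
          forall (xk : nat -> 'rV[R]_n) (vk : nat -> 'rV[R]_(q j))
                 (xsk : nat -> 'rV[R]_n) (xs : 'rV[R]_n),
            (forall k, eball xb d (xk k) /\ V j (vk k)) ->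
            xk @ \oo --> xb -> vk @ \oo --> vb ->
            (forall k, dxg j (xk k) (vk k) (xsk k)) -> xsk @ \oo --> xs ->
            dxg j xb vb xs].

Definition Omega : set 'rV[R]_n :=
  [set x | S x /\ forall j v, V j v -> g j x v <= 0].

Definition Omega_E (theta : R) : set 'rV[R]_n :=
  [set x | S x /\ forall j, gmax j x <= Num.sqrt theta].

Definition stationary (theta : R) (y : 'rV[R]_n) (lam : 'I_p -> R) : Prop :=
  exists (zL zU : 'I_m -> 'rV[R]_n) (c : 'I_p -> 'rV[R]_n) (w b : 'rV[R]_n),
    [/\ forall i, limiting_subdiff (fL i) y (zL i) /\
                  limiting_subdiff (fU i) y (zU i),
        forall j,
          convex_hull (\bigcup_(v in active j y) dxg j y v) (c j),
        limiting_normal S y w,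
        unit_ball b &
        0 = \sum_(i < m) (zL i + zU i) + \sum_(j < p) lam j *: c j
            + w + Num.sqrt theta *: b].

Definition KKT_pair (theta : R) (z : 'rV[R]_n) (lam : 'I_p -> R) : Prop :=
  [/\ Omega_E theta z, forall j, 0 <= lam j, stationary theta z lam,
      forall j, 0 < gmax j z <= Num.sqrt theta -> 0 < lam j &
      forall j, gmax j z <= 0 -> lam j = 0].

Definition Omega_D (theta : R) (zE : 'rV[R]_n) (lamE : 'I_p -> R)
    (y : 'rV[R]_n) (lam : 'I_p -> R) : Prop :=
  [/\ S y, forall j, 0 <= lam j, stationary theta y lam &
      forall j, 0 < gmax j zE <= Num.sqrt theta -> lam j <= lamE j].

(* The subgradients x*_{v_j} form an arbitrary finite family of pairs
   (v j k, xs j k) in the graph of v |-> dxg j z v, in which the same parameter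
   may carry several subgradients: the convex hulls in [stationary] combine
   subgradients of that kind.  If each parameter carried a single subgradient,
   weak duality would fail, e.g. for n = 2, p = m = 1, S = R^2, V_1 a
   singleton, g(x) = x_2 - |x_1|, f(x) = [- c x_2, - c x_2], c large, y = 0. *)
Definition generalized_convex (z : 'rV[R]_n) : Prop :=
  forall (x : 'rV[R]_n) (zL zU : 'I_m -> 'rV[R]_n)
         (K : 'I_p -> nat) (v : forall j, 'I_(K j) -> 'rV[R]_(q j))
         (xs : forall j, 'I_(K j) -> 'rV[R]_n),
    S x ->
    (forall i, limiting_subdiff (fL i) z (zL i)) ->
    (forall i, limiting_subdiff (fU i) z (zU i)) ->
    (forall j k, active j z (v j k) /\ dxg j z (v j k) (xs j k)) ->
    exists omega : 'rV[R]_n,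
      [/\ polar_cone (limiting_normal S z) omega,
          forall i, fL i x - fL i z >= dotp (zL i) omega /\
                    fU i x - fU i z >= dotp (zU i) omega,
          forall j k, g j x (v j k) - g j z (v j k) >= dotp (xs j k) omega &
          forall bs, unit_ball bs -> dotp bs omega <= enorm (x - z)].

End Robust.

(* Main.v *)
Require Import Defs.
From mathcomp Require Import all_boot all_order all_algebra.
From mathcomp Require Import all_classical all_reals all_analysis.
From mathcomp Require Import ring lra.

Set Implicit Arguments.
Unset Strict Implicit.
Unset Printing Implicit Defensive.

Import Order.TTheory GRing.Theory Num.Theory.
Import numFieldNormedType.Exports.

Local Open Scope classical_set_scope.
Local Open Scope ring_scope.

(** Why weak duality holds.  Adding the two endpoints of every objective turns
    the interval problem into a scalar one, with [F = \sum_i (fL i + fU i)].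
    Write the stationarity condition at [y] as a vanishing sum of subgradients,
    of a normal to [S] and of [Num.sqrt theta *: b] with [b] in the unit ball,
    and pair it with the direction [omega] that generalized convexity provides
    for a point [x] of [Omega].  The subgradients of the objectives contribute
    at most [F x - F y], the normal at most 0, and the ball term at most
    [Num.sqrt theta * enorm (x - y)].  The constraint terms contribute at most
    0: for an active parameter [v],
    [g j x v <= gmax g V j x <= gmax g V j y = g j y v].  Hence
    [F y - Num.sqrt theta * enorm (x - y) <= F x]
    ([stationary_sum_lower_bound]).

    A point [x] dominating [y] would contradict this.  Summing its inequalities
    over all endpoints, one of them strict, gives
    [F x < F y - theta / Num.sqrt theta * enorm (x - y)], because [theta] is
    the sum of all the endpoints of the tolerances, and
    [theta / Num.sqrt theta = Num.sqrt theta]. *)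

Lemma dependent_choice_fun (I : Type) (T : I -> Type)
    (P : forall i, T i -> Prop) :
  (forall i, exists t, P i t) -> exists t : forall i, T i, forall i, P i (t i).
Proof. by move=> H; exists (fun i => sval (cid (H i))) => i; case: cid. Qed.

Section InnerProduct.
Variables (R : realType) (n : nat).
Implicit Types x y z : 'rV[R]_n.

Lemma dotpC x y : dotp x y = dotp y x.
Proof. by apply: eq_bigr => i _; rewrite mulrC. Qed.

Lemma dotp0l y : dotp 0 y = 0.
Proof. by rewrite /dotp big1 // => i _; rewrite mxE mul0r. Qed.

Lemma dotpDl x y z : dotp (x + y) z = dotp x z + dotp y z.
Proof. by rewrite -big_split; apply: eq_bigr => i _; rewrite mxE mulrDl. Qed.

Lemma dotpZl a x y : dotp (a *: x) y = a * dotp x y.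
Proof. by rewrite /dotp mulr_sumr; apply: eq_bigr => i _; rewrite mxE mulrA. Qed.

Lemma dotp_suml (I : finType) (u : I -> 'rV[R]_n) y :
  dotp (\sum_i u i) y = \sum_i dotp (u i) y.
Proof.
exact: (big_morph (fun x => dotp x y) (fun a b => dotpDl a b y) (dotp0l y)).
Qed.

Lemma convex_hull_bigcup (T : Type) (D : set T) (A : T -> set 'rV[R]_n) x :
  convex_hull (\bigcup_(t in D) A t) x ->
  exists k (a : 'I_k -> R) (t : 'I_k -> T) (u : 'I_k -> 'rV[R]_n),
    [/\ forall i, 0 <= a i, forall i, D (t i) /\ A (t i) (u i) &
        x = \sum_(i < k) a i *: u i].
Proof.
move=> [k [a [u [a_ge0 _ Au ->]]]].
have /choice[t ht] : forall i, exists t, D t /\ A t (u i).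
  by move=> i; have [t Dt At] := Au i; exists t.
by exists k, a, t, u.
Qed.

End InnerProduct.

Section IntervalSums.
Variable R : realType.
Implicit Types A B : R * R.

Lemma leLU_sum A B : leLU A B -> A.1 + A.2 <= B.1 + B.2.
Proof. by case=> h1 h2; rewrite lerD. Qed.

Lemma ltLU_sum A B : ltLU A B -> A.1 + A.2 < B.1 + B.2.
Proof.
case: A B => [a1 a2] [b1 b2] [[/= h1 h2]] neqAB; rewrite ltNge; apply/negP => h.
by apply: neqAB; congr pair; lra.
Qed.

End IntervalSums.

Section WeakDuality.
Variables (R : realType) (n m p : nat) (q : 'I_p -> nat).
Variables (S : set 'rV[R]_n) (f : 'I_m -> 'rV[R]_n -> R * R).
Variables (g : forall j : 'I_p, 'rV[R]_n -> 'rV[R]_(q j) -> R).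
Variables (V : forall j : 'I_p, set 'rV[R]_(q j)).
Arguments g : clear implicits.
Arguments V : clear implicits.

(** Feasibility of [x] bounds all the values [g j x v] by 0, so that the
    supremum defining [gmax] is a genuine upper bound. *)
Lemma gmax_ub x j v : Omega S g V x -> V j v -> g j x v <= gmax g V j x.
Proof.
move=> [_ gx] Vv; apply: ub_le_sup; last by exists v.
by exists 0 => _ [w Vw <-]; apply: gx.
Qed.

Lemma active_le x y j (v : 'rV[R]_(q j)) : Omega S g V x -> gmax g V j x <= gmax g V j y ->
  active g V y v -> g j x v <= g j y v.
Proof. by move=> Ox gxy [Vv ->]; apply: le_trans gxy; apply: gmax_ub. Qed.

(** The same [omega] has to serve all the terms of the stationarity condition.
    A hull element pairs with [omega] as the convex combination of the pairings
    of its generators, so the family handed to generalized convexity consists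
    of all the generators in a representation of the hull element of each
    constraint. *)
Lemma stationary_sum_lower_bound theta y lam x :
  (forall j, 0 <= lam j) -> stationary S f g V theta y lam ->
  generalized_convex S f g V y -> Omega S g V x ->
  (forall j, gmax g V j x <= gmax g V j y) ->
  \sum_(i < m) (fL f i y + fU f i y) - Num.sqrt theta * enorm (x - y)
    <= \sum_(i < m) (fL f i x + fU f i x).
Proof.
move=> lam_ge0 [zL [zU [c [w [b [hz hc hw hb stat]]]]]] gc Ox gxy.
have [K /dependent_choice_fun[a /dependent_choice_fun[v]]] :=
  dependent_choice_fun (fun j => convex_hull_bigcup (hc j)).
move=> /dependent_choice_fun[u hull].
have [||||om [om_polar om_f om_g om_ball]] := gc x zL zU K v u.
- by case: Ox.
- by move=> i; case: (hz i).
- by move=> i; case: (hz i).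
- by move=> j k; have [_ + _] := hull j; apply.
have dotp_stat : \sum_(i < m) (dotp (zL i) om + dotp (zU i) om)
    + \sum_(j < p) lam j * dotp (c j) om + dotp w om
    + Num.sqrt theta * dotp b om = 0.
  have := dotp0l om; rewrite [X in dotp X _]stat !dotpDl dotpZl !dotp_suml.
  apply: etrans; congr (_ + _ + _ + _);
    by apply: eq_bigr => i _; rewrite ?dotpDl ?dotpZl.
have objectives : \sum_(i < m) (dotp (zL i) om + dotp (zU i) om) <=
    \sum_(i < m) (fL f i x + fU f i x) - \sum_(i < m) (fL f i y + fU f i y).
  rewrite -sumrB; apply: ler_sum => i _.
  by have [hL hU] := om_f i; lra.
have constraints : \sum_(j < p) lam j * dotp (c j) om <= 0.
  apply: sumr_le0 => j _; apply: mulr_ge0_le0 => //.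
  have [a_ge0 act ->] := hull j.
  rewrite dotp_suml; apply: sumr_le0 => k _; rewrite dotpZl.
  apply: mulr_ge0_le0 => //; apply: le_trans (om_g j k) _.
  by rewrite subr_le0; apply: active_le (gxy j) (act k).1.
have normal : dotp w om <= 0 by rewrite dotpC; apply: om_polar.
have ball : Num.sqrt theta * dotp b om <= Num.sqrt theta * enorm (x - y).
  by apply: ler_wpM2l; [exact: sqrtr_ge0 | exact: om_ball].
lra.
Qed.

End WeakDuality.

Theorem theorem4p2 (R : realType) (n m p : nat) (q : 'I_p -> nat)
    (S : set 'rV[R]_n) (S_nonempty : S !=set0) (S_closed : closed S)
    (f : 'I_m -> 'rV[R]_n -> R * R)
    (f_Kc : forall i x, is_Kc (f i x))
    (fL_lip : forall i, locally_lipschitz (fL f i))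
    (fU_lip : forall i, locally_lipschitz (fU f i))
    (V : forall j : 'I_p, set 'rV[R]_(q j))
    (V_nonempty : forall j, V j !=set0) (V_compact : forall j, compact (V j))
    (g : forall j : 'I_p, 'rV[R]_n -> 'rV[R]_(q j) -> R)
    (g_standing : standing_conditions g V)
    (eps : 'I_m -> R * R)
    (eps_ge0 : forall i, 0 <= (eps i).1) (eps_Kc : forall i, is_Kc (eps i))
    (theta : R) (theta_def : theta = \sum_(i < m) ((eps i).1 + (eps i).2))
    (theta_gt0 : 0 < theta)
    (zE : 'rV[R]_n) (lamE : 'I_p -> R)
    (KKT : KKT_pair S f g V theta zE lamE)
    (y : 'rV[R]_n) (lam : 'I_p -> R)
    (y_feasible : Omega_D S f g V theta zE lamE y lam)
    (fg_convex : generalized_convex S f g V y)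
    (g_le : forall x, Omega S g V x -> forall j, gmax g V j x <= gmax g V j y) :
  ~ exists x : 'rV[R]_n,
      [/\ Omega S g V x,
          forall i, leLU (f i x)
            (isub (f i y)
                  (iscale (enorm (x - y)) (iscale (Num.sqrt theta)^-1 (eps i)))) &
          exists i, ltLU (f i x)
            (isub (f i y)
                  (iscale (enorm (x - y)) (iscale (Num.sqrt theta)^-1 (eps i))))].
Proof.
move=> [x [Ox dom [i0 strict]]].
have [_ lam_ge0 stat _] := y_feasible.
have := stationary_sum_lower_bound lam_ge0 stat fg_convex Ox (g_le x Ox).
apply/negP; rewrite -ltNge.
set r := enorm (x - y); set s := Num.sqrt theta.
have theta_over_s : r * (s^-1 * theta) = s * r.
  have s_neq0 : s != 0 by rewrite gt_eqF // sqrtr_gt0.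
  have -> : theta = s * s by rewrite -expr2 sqr_sqrtr // ltW.
  by rewrite mulKf // mulrC.
rewrite -theta_over_s theta_def !mulr_sumr -sumrB.
have endpoints i : (isub (f i y) (iscale r (iscale s^-1 (eps i)))).1
    + (isub (f i y) (iscale r (iscale s^-1 (eps i)))).2
    = fL f i y + fU f i y - r * (s^-1 * ((eps i).1 + (eps i).2)).
  by rewrite /fL /fU /=; ring.
rewrite (bigD1 i0) //= [ltRHS](bigD1 i0) //=; apply: ltr_leD.
  by rewrite -endpoints; apply: ltLU_sum.
by apply: ler_sum => i _; rewrite -endpoints; apply: leLU_sum.
Qed.
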